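(* Let $K\ge 1$ and let $g_1,\dots,g_K$ be positive integers. Consider a $K$-plane point-mass lensing ensemble with $g_i$ point masses in the $i$-th plane: point-mass positions $y_{i,\ell}\in\mathbb{C}$ and scaled masses $m_{i,\ell}>0$ ($1\le i\le K$, $1\le \ell\le g_i$), and nonzero real scaling constants $\beta_{j,i}$ ($1\le j<i\le K$). Define the lensing map $\eta$ by $$\eta(x)=x-\sum_{k=1}^K \alpha_k(x_k),\qquad x_1=x,\quad x_i=x-\sum_{j=1}^{i-1}\beta_{j,i}\,\alpha_j(x_j)\ (i=2,\dots,K),\qquad \alpha_i(x_i)=\sum_{\ell=1}^{g_i}\frac{m_{i,\ell}}{\overline{x_i}-\overline{y_{i,\ell}}},$$ defined on $\mathbb{C}$ minus the obstruction points (those $x$ for which some denominator vanishes). Let $w\in\mathbb{C}$ be a source position that is not a critical value (caustic point) of $\eta$, and suppose the ensemble is generic. Let $F(Z)=\prod_{i=1}^K(1+g_iZ)$ and $$E_K=\frac{F(1)+F(-1)}{2},\qquad O_K=\frac{F(1)-F(-1)}{2},$$ i.e. the sums of the coefficients of the even-degree and odd-degree terms of $F$ respectively. Then the number $N$ of images, i.e. of solutions $x$ of $\eta(x)=w$, satisfies $$N\le E_K^2+O_K^2.$$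
   Context: Here $\mathbb{C}$ is identified with $\mathbb{R}^2$ and $\eta$ is regarded as a map $\mathbb{R}^2\setminus\{\text{obstruction points}\}\to\mathbb{R}^2$; the bar denotes complex conjugation. A critical point of $\eta_w(x)=\eta(x)-w$ is a point where the Jacobian determinant of $\eta$ vanishes; $w$ is a caustic point if it equals $\eta(x)$ for some critical point $x$. ''Generic'' means the parameters (positions, masses, scaling constants, source) are such that the lensing equation $\eta(x)=w$ has finitely many solutions, none of them degenerate (i.e. $w$ is not a caustic point). *)

(* Defs.v *)
From Stdlib Require Import Reals List.
From Coquelicot Require Import Coquelicot.
Import ListNotations.
Open Scope R_scope.

(* Data of a K-plane point-mass ensemble (1-based indices):
   g i     : number of point masses in plane i
   y i l   : position of the l-th point mass in plane i
   m i l   : its scaled mass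
   beta j i: scaling constant, 1 <= j < i <= K *)

Definition Csum (l : list C) : C := fold_right Cplus (RtoC 0) l.

Definition alpha (g : nat -> nat) (y : nat -> nat -> C) (m : nat -> nat -> R)
  (i : nat) (z : C) : C :=
  Csum (map (fun l => Cdiv (RtoC (m i l)) (Cminus (Cconj z) (Cconj (y i l))))
            (seq 1 (g i))).

(* xs_list n x = [x_1; ...; x_n] with x_1 = x and
   x_i = x - sum_{j=1}^{i-1} beta_{j,i} alpha_j(x_j). *)
Fixpoint xs_list (g : nat -> nat) (y : nat -> nat -> C) (m : nat -> nat -> R)
  (beta : nat -> nat -> R) (n : nat) (x : C) : list C :=
  match n with
  | O => []
  | S n' =>
      let l := xs_list g y m beta n' x in
      l ++ [Cminus x (Csum (map (fun j =>
               Cmult (RtoC (beta j n)) (alpha g y m j (nth (j - 1) l (RtoC 0))))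
               (seq 1 n')))]
  end.

Definition xpos (g : nat -> nat) (y : nat -> nat -> C) (m : nat -> nat -> R)
  (beta : nat -> nat -> R) (K i : nat) (x : C) : C :=
  nth (i - 1) (xs_list g y m beta K x) (RtoC 0).

Definition eta (g : nat -> nat) (y : nat -> nat -> C) (m : nat -> nat -> R)
  (beta : nat -> nat -> R) (K : nat) (x : C) : C :=
  Cminus x (Csum (map (fun k => alpha g y m k (xpos g y m beta K k x)) (seq 1 K))).

Definition in_domain (g : nat -> nat) (y : nat -> nat -> C) (m : nat -> nat -> R)
  (beta : nat -> nat -> R) (K : nat) (x : C) : Prop :=
  forall i l, (1 <= i <= K)%nat -> (1 <= l <= g i)%nat ->
    xpos g y m beta K i x <> y i l.

Definition jac_det (g : nat -> nat) (y : nat -> nat -> C) (m : nat -> nat -> R)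
  (beta : nat -> nat -> R) (K : nat) (x : C) : R :=
  let u := fun a b => fst (eta g y m beta K (a, b)) in
  let v := fun a b => snd (eta g y m beta K (a, b)) in
  Derive (fun a => u a (snd x)) (fst x) * Derive (fun b => v (fst x) b) (snd x)
  - Derive (fun b => u (fst x) b) (snd x) * Derive (fun a => v a (snd x)) (fst x).

Definition critical_point g y m beta K (x : C) : Prop :=
  in_domain g y m beta K x /\ jac_det g y m beta K x = 0.

Definition caustic_point g y m beta K (w : C) : Prop :=
  exists x, critical_point g y m beta K x /\ eta g y m beta K x = w.

Definition is_image g y m beta K (w x : C) : Prop :=
  in_domain g y m beta K x /\ eta g y m beta K x = w.

Definition Fpoly (g : nat -> nat) (K : nat) (z : R) : R :=
  fold_right Rmult 1 (map (fun i => 1 + INR (g i) * z) (seq 1 K)).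

Definition E_K (g : nat -> nat) (K : nat) : R := (Fpoly g K 1 + Fpoly g K (-1)) / 2.
Definition O_K (g : nat -> nat) (K : nat) : R := (Fpoly g K 1 - Fpoly g K (-1)) / 2.

(* Main.v *)
Require Import Defs.
From Stdlib Require Import Reals List Lra.
From Coquelicot Require Import Coquelicot.
From mathcomp Require all_boot all_fingroup all_algebra boolp complex Rstruct.
Open Scope R_scope.

(* Treat z and v = conj z as independent variables.  By induction on the planes,
   the deflections in the first n planes have a common denominator D of bidegree
   (E_n - 1, O_n) in (z, v), so clearing denominators turns eta(x) = w into
   P(z, v) = 0 with P of bidegree (E_K, O_K); conjugation gives a second equation
   P*(z, v) = 0 of bidegree (O_K, E_K).  A common factor of P and P* cannot vanish
   at an image, since the Jacobian of eta would vanish there; so it can be divided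
   out.  The resultant in v of the two cofactors is then a nonzero polynomial in z
   of degree at most E_K^2 + O_K^2, and every image is one of its roots. *)

(** * Continuity and derivatives of complex-valued functions of a real variable *)

Definition Ccont (q : R -> C) (t : R) : Prop :=
  continuity_pt (fun s => fst (q s)) t /\ continuity_pt (fun s => snd (q s)) t.

Lemma Ccont_const (c : C) t : Ccont (fun _ => c) t.
Proof. split; apply continuity_pt_const; intros ? ?; reflexivity. Qed.

Lemma Ccont_ext p q t : (forall s, p s = q s) -> Ccont p t -> Ccont q t.
Proof.
intros e [p1 p2]; split.
- now apply (continuity_pt_ext (fun s => fst (p s))); [intros s; rewrite e|].
- now apply (continuity_pt_ext (fun s => snd (p s))); [intros s; rewrite e|].
Qed.

Lemma Ccont_plus p q t : Ccont p t -> Ccont q t -> Ccont (fun s => Cplus (p s) (q s)) t.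
Proof. intros [p1 p2] [q1 q2]; split; simpl; now apply continuity_pt_plus. Qed.

Lemma Ccont_mult p q t : Ccont p t -> Ccont q t -> Ccont (fun s => Cmult (p s) (q s)) t.
Proof.
intros [p1 p2] [q1 q2]; split; simpl.
- apply continuity_pt_minus; now apply continuity_pt_mult.
- apply continuity_pt_plus; now apply continuity_pt_mult.
Qed.

Lemma Ccont_conj q t : Ccont q t -> Ccont (fun s => Cconj (q s)) t.
Proof. intros [q1 q2]; split; simpl; [easy | now apply continuity_pt_opp]. Qed.

Lemma Cnormsq_neq0 (z : C) : z <> RtoC 0 -> (fst z) ^ 2 + (snd z) ^ 2 <> 0.
Proof.
destruct z as [a b]; simpl; intros nz e; apply nz.
assert (a = 0) by nra; assert (b = 0) by nra; now subst.
Qed.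

Lemma Ccont_normsq q t : Ccont q t ->
  continuity_pt (fun s => (fst (q s)) ^ 2 + (snd (q s)) ^ 2) t.
Proof.
intros [q1 q2]; simpl; apply continuity_pt_plus;
  repeat (apply continuity_pt_mult; trivial); apply continuity_pt_const; intros ? ?; reflexivity.
Qed.

Lemma Ccont_div p q t : Ccont p t -> Ccont q t -> q t <> RtoC 0 ->
  Ccont (fun s => Cdiv (p s) (q s)) t.
Proof.
intros hp hq q0; apply Ccont_mult; [easy|].
pose proof (Cnormsq_neq0 _ q0); pose proof (Ccont_normsq _ _ hq); destruct hq as [q1 q2].
split; simpl; apply continuity_pt_div; trivial; now apply continuity_pt_opp.
Qed.

Lemma Ccont_neq0 q t : Ccont q t -> q t <> RtoC 0 -> locally t (fun s => q s <> RtoC 0).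
Proof.
intros hq q0.
pose proof (Cnormsq_neq0 _ q0) as n0; pose proof (Ccont_normsq _ _ hq) as hc.
apply continuity_pt_filterlim in hc.
assert (h : locally t (fun s => fst (q s) ^ 2 + snd (q s) ^ 2 <> 0)).
  { apply (hc (fun x => x <> 0)); apply (open_neq 0); exact n0. }
revert h; apply filter_imp; intros s hs e; apply hs; rewrite e; simpl; ring.
Qed.

(** Taking [s = t] forces [c = f t], so near [t] the difference quotient of [f] is [k] itself. Only
    continuity of [k] is used, never its differentiability. *)
Lemma is_derive_factor (f k : R -> R) (c t : R) :
  locally t (fun s => f s - c = (s - t) * k s) -> continuity_pt k t -> is_derive f t (k t).
Proof.
intros [d hd] hk; apply is_derive_Reals; intros eps heps.
destruct (hk eps heps) as [al [al0 hal]].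
assert (d0 : 0 < Rmin d al) by (apply Rmin_pos; [apply cond_pos | easy]).
exists (mkposreal _ d0); simpl; intros h h0 hh.
pose proof (Rmin_l d al); pose proof (Rmin_r d al).
assert (e1 : f (t + h) - c = (t + h - t) * k (t + h)).
{ apply hd; unfold ball; simpl; unfold AbsRing_ball, abs, minus, plus, opp; simpl.
  replace (t + h + - t) with h by ring; lra. }
assert (e2 : f t - c = (t - t) * k t) by (apply hd, ball_center).
replace ((f (t + h) - f t) / h) with (k (t + h)); cycle 1.
{ replace (f (t + h) - f t) with (h * k (t + h)) by lra; field; easy. }
apply hal; split.
- split; [easy | lra].
- simpl; unfold Rdist; replace (t + h - t) with h by ring; lra.
Qed.

Lemma Cderive_factor (f q : R -> C) (w : C) (t : R) :
  locally t (fun s => Cminus (f s) w = Cmult (RtoC (s - t)) (q s)) -> Ccont q t ->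
  is_derive (fun s => fst (f s)) t (fst (q t)) /\ is_derive (fun s => snd (f s)) t (snd (q t)).
Proof.
intros hf [q1 q2].
split.
- apply (is_derive_factor _ (fun s => fst (q s)) (fst w)); trivial.
  revert hf; apply filter_imp; intros s e; apply (f_equal fst) in e; simpl in e.
  unfold Rminus at 1; rewrite e; ring.
- apply (is_derive_factor _ (fun s => snd (q s)) (snd w)); trivial.
  revert hf; apply filter_imp; intros s e; apply (f_equal snd) in e; simpl in e.
  unfold Rminus at 1; rewrite e; ring.
Qed.

(** The two factorizations give the derivative of [f] at [t] twice, as [k h1] and as the conjugate
    of [k h2]; uniqueness of derivatives equates them. *)
Lemma Cderive_line (f h1 h2 k : R -> C) (w : C) (t : R) :
  locally t (fun s => Cminus (f s) w = Cmult (Cmult (RtoC (s - t)) (k s)) (h1 s)) ->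
  locally t (fun s => Cconj (Cminus (f s) w) = Cmult (Cmult (RtoC (s - t)) (k s)) (h2 s)) ->
  Ccont k t -> Ccont h1 t -> Ccont h2 t ->
  Derive (fun s => fst (f s)) t = fst (Cmult (k t) (h1 t)) /\
  Derive (fun s => snd (f s)) t = snd (Cmult (k t) (h1 t)) /\
  Cconj (Cmult (k t) (h1 t)) = Cmult (k t) (h2 t).
Proof.
intros e1 e2 ck c1 c2.
destruct (Cderive_factor f (fun s => Cmult (k s) (h1 s)) w t) as [d1 d2].
{ revert e1; apply filter_imp; intros s ->; ring. }
{ now apply Ccont_mult. }
destruct (Cderive_factor f (fun s => Cconj (Cmult (k s) (h2 s))) w t) as [d3 d4].
{ revert e2; apply filter_imp; intros s e.
  rewrite <- (Cconj_conj (Cminus (f s) w)), e, <- Cmult_assoc, Cmult_conj.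
  f_equal; apply injective_projections; simpl; ring. }
{ now apply Ccont_conj, Ccont_mult. }
apply is_derive_unique in d1; apply is_derive_unique in d2;
apply is_derive_unique in d3; apply is_derive_unique in d4.
split; [easy|split; [easy|]].
rewrite <- (Cconj_conj (Cmult (k t) (h2 t))); f_equal.
apply injective_projections; [now rewrite <- d1, <- d3 | now rewrite <- d2, <- d4].
Qed.

(** With [p = a h1] and [q = b h1], both [conj p * q] and [p * conj q] equal [a b h1 h2]. Hence
    [conj p * q] is real, and the expression is its imaginary part: [p] and [q] are parallel as real
    vectors. *)
Lemma jacobian_of_common_factor (a b h1 h2 : C) :
  Cconj (Cmult a h1) = Cmult a h2 -> Cconj (Cmult b h1) = Cmult b h2 ->
  fst (Cmult a h1) * snd (Cmult b h1) - fst (Cmult b h1) * snd (Cmult a h1) = 0.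
Proof.
intros ea eb.
assert (e : Cmult (Cconj (Cmult a h1)) (Cmult b h1) = Cmult (Cmult a h1) (Cconj (Cmult b h1)))
  by (rewrite ea, eb; ring).
apply (f_equal snd) in e; simpl in e; simpl; lra.
Qed.

Module Lensing.
Import mathcomp.boot.all_boot mathcomp.fingroup.all_fingroup mathcomp.algebra.all_algebra.
Import mathcomp.real_closed.complex mathcomp.reals_stdlib.Rstruct.
Set Implicit Arguments.
Unset Strict Implicit.
Unset Printing Implicit Defensive.
Import GRing.Theory.
Local Open Scope ring_scope.

(** * Common zeros of bivariate polynomials *)

Section Degree.
Variable R : idomainType.
Implicit Types u v : {poly {poly R}}.

(** [a] bounds the degree in the inner variable, later [z], and [b] the degree in the outer
    variable, later [conj z]. *)
Definition bideg_le (a b : nat) u := (sizeY u <= a.+1)%N && (size u <= b.+1)%N.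

(** Every product in the Leibniz expansion takes one entry from each row, so the row bounds add
    up. *)
Lemma size_det_leq n (A : 'M[{poly R}]_n) (d : 'I_n -> nat) :
  (forall i j, (size (A i j) <= (d i).+1)%N) -> (size (\det A) <= (\sum_i d i).+1)%N.
Proof.
move=> Ad; apply: leq_trans (size_sum _ _ _) _; apply/bigmax_leqP => s _.
rewrite -[(-1) ^+ s](rmorph_sign polyC) size_Cmul; last by rewrite signr_eq0.
apply: leq_trans (size_poly_prod_leq _ _) _.
rewrite leq_subLR cardT size_enum_ord addnS ltnS.
rewrite -[X in (_ <= X + _)%N]card_ord -sum1_card.
by rewrite -big_split /=; apply: leq_sum => i _; rewrite add1n.
Qed.

(** The Sylvester matrix has [(size v).-1] rows of coefficients of [u] and [(size u).-1] rows of
    coefficients of [v]; [d] bounds the inner degree in each row. *)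
Lemma size_resultant_leq u v :
  (size (resultant u v) <=
   ((size v).-1 * (sizeY u).-1 + (size u).-1 * (sizeY v).-1).+1)%N.
Proof.
pose d (i : 'I_((size v).-1 + (size u).-1)) :=
  match split i with inl _ => (sizeY u).-1 | inr _ => (sizeY v).-1 end.
have -> : ((size v).-1 * (sizeY u).-1 + (size u).-1 * (sizeY v).-1 = \sum_i d i)%N.
  rewrite big_split_ord /=; congr (_ + _)%N; rewrite -[in LHS](card_ord _.-1) -sum_nat_const;
    apply: eq_bigr => i _; rewrite /d.
    by rewrite (unsplitK (inl _ i)).
  by rewrite (unsplitK (inr _ i)).
apply: size_det_leq => i j; rewrite Sylvester_mxE /d.
by case: (split i) => k /=; case: (k <= j)%N; rewrite ?mulr1n ?mulr0n ?size_poly0 //;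
   apply: leq_trans (max_size_coefXY _ _) (leqSpred _).
Qed.

Lemma root_resultant u v x y : (1 < size u)%N -> (1 < size v)%N ->
  u.[x, y] = 0 -> v.[x, y] = 0 -> root (resultant u v) y.
Proof.
move=> su sv u0 v0; have [[p q] _ /= e] := resultant_in_ideal su sv.
move: (congr1 (fun w : {poly {poly R}} => w.[x, y]) e).
by rewrite hornerC hornerD !hornerM hornerD !hornerM u0 v0 !mulr0 addr0 => /eqP.
Qed.

Lemma bideg_le_mulr a b u v : v != 0 -> u != 0 -> bideg_le a b (u * v) -> bideg_le a b v.
Proof.
move=> v0 u0 /andP[]; rewrite /bideg_le !sizeYE rmorphM /=.
rewrite !size_mul ?swapXY_eq0 // => hy hx.
rewrite -!size_poly_gt0 -?(swapXY_eq0 u) in v0 u0.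
have u1 : (0 < size (swapXY u))%N by rewrite size_poly_gt0 swapXY_eq0 -size_poly_gt0.
apply/andP; split; [apply: leq_trans hy|apply: leq_trans hx]; rewrite -subn1 leq_subRL ?addn_gt0 ?u0 ?u1 //;
  by rewrite leq_add2r.
Qed.

End Degree.

(** * Gauss's lemma and the count of common zeros *)

Section Gauss.
Variable F : closedFieldType.
Implicit Types u v g : {poly {poly F}}.

(** Over an algebraically closed field this says that the content of [g] is a unit: no ['X - a%:P]
    divides all its coefficients. *)
Definition primitive g := forall a : F, map_poly (horner_eval a) g != 0.

Lemma dvd_linear_coef (a : F) u : map_poly (horner_eval a) u = 0 ->
  exists v, u = ('X - a%:P)%:P * v.
Proof.
move=> u0; exists (map_poly (fun c => c %/ ('X - a%:P)) u); apply/polyP => i.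
rewrite coefCM coef_map_id0 ?div0p // mulrC divpK // dvdp_XsubCl /root.
by move: (congr1 (fun p : {poly F} => p`_i) u0); rewrite coef0 coef_map /= /horner_eval => ->.
Qed.

(* Each linear factor of [c] divides [g * v], hence [v], as [g] is primitive. *)
Lemma primitive_cancel g (c : {poly F}) u v : primitive g -> c != 0 ->
  c%:P * u = g * v -> exists v', u = g * v'.
Proof.
move=> pg; have [n] := ubnP (size c); elim: n c v => // n IH c v /ltnSE sc c0 e.
have [/size1_polyC ec|] := leqP (size c) 1.
  exists ((c`_0)^-1%:P%:P * v); rewrite mulrCA -e mulrA -polyCM ec coefC eqxx -polyCM.
  by rewrite mulVf ?mul1r //; apply: contraNneq c0 => c00; rewrite ec c00.
move=> /gtn_eqF/negbT/closed_rootP[a].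
rewrite -dvdp_XsubCl => /dvdpP[c' ec].
have : map_poly (horner_eval a) v = 0.
  move: (congr1 (map_poly (horner_eval a)) e); rewrite !rmorphM /= map_polyC /= ec.
  rewrite {1}/horner_eval hornerM hornerXsubC subrr mulr0 mul0r => /esym/eqP.
  by rewrite mulf_eq0 (negPf (pg a)) => /eqP.
case/dvd_linear_coef => v' ev.
have X0 : 'X - a%:P != 0 :> {poly F} by rewrite polyXsubC_eq0.
have c'0 : c' != 0 by apply: contraNneq c0 => c'0; rewrite ec c'0 mul0r.
apply: (IH c' v') => //.
  move: sc; rewrite ec size_mul // size_XsubC addn2 /=; exact.
apply: (@mulfI _ ('X - a%:P)%:P); first by rewrite polyC_eq0.
by rewrite mulrA -polyCM (mulrC _ c') -ec e ev mulrCA.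
Qed.

(** Linear factors in the inner variable are split off one at a time; each lowers the degree of the
    leading coefficient, which bounds the induction. *)
Lemma primitive_part g : g != 0 ->
  exists c h, [/\ c != 0, primitive h & g = c%:P * h].
Proof.
have [n] := ubnP (size (lead_coef g)); elim: n g => // n IH g /ltnSE sg g0.
have [[a /dvd_linear_coef[h eg]]|ng] :=
  boolp.pselect (exists a, map_poly (horner_eval a) g = 0); last first.
  exists 1, g; split; rewrite ?oner_eq0 ?mul1r // => a.
  by apply/eqP => ga; apply: ng; exists a.
have h0 : h != 0 by apply: contraNneq g0 => h0; rewrite eg h0 mulr0.
have X0 : 'X - a%:P != 0 :> {poly F} by rewrite polyXsubC_eq0.
have [|c [k [c0 pk eh]]] := IH h _ h0.
  by move: sg; rewrite eg lead_coefM lead_coefC size_mul ?lead_coef_eq0 ?size_XsubC.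
exists (('X - a%:P) * c), k; split; rewrite ?mulf_neq0 //.
by rewrite eg eh mulrA -polyCM.
Qed.

(** [gcdp] divides [u] and [v] only up to a nonzero factor in the inner variable. Replacing it by
    its primitive part [h] turns this into exact division, by Gauss's lemma. *)
Lemma cofactors_of_gcd u v : u != 0 -> v != 0 -> exists h u1 v1,
  [/\ u = h * u1, v = h * v1 & resultant u1 v1 != 0].
Proof.
move=> u0 v0; have g0 : gcdp u v != 0 by rewrite gcdp_eq0 negb_and u0.
have [c [h [c0 ph eg]]] := primitive_part g0.
have dv w : gcdp u v %| w -> exists w1, w = h * w1.
  case/Pdiv.Idomain.dvdpP=> -[d q] /= d0 e.
  apply: (@primitive_cancel h d w (c%:P * q)) => //.
  by rewrite mul_polyC e eg mulrC mulrCA mulrA.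
have [u1 eu] := dv u (dvdp_gcdl u v); have [v1 ev] := dv v (dvdp_gcdr u v).
exists h, u1, v1; split=> //; rewrite resultant_eq0 -leqNgt.
have u10 : u1 != 0 by apply: contraNneq u0 => e; rewrite eu e mulr0.
have h0 : h != 0 by apply: contraNneq u0 => e; rewrite eu e mul0r.
(* [h * gcdp u1 v1] and [gcdp u v] have the same size, and so do [gcdp u v] and [h]. Hence
   [gcdp u1 v1] has size 1, which makes the resultant nonzero. *)
have := eqp_size (gcdp_mul2l h u1 v1); rewrite -eu -ev eg size_mul ?gcdp_eq0 ?negb_and ?u10 //.
rewrite mul_polyC size_scale // -subn1 => /eqP; rewrite -(eqn_add2r 1) subnK ?addn_gt0 ?size_poly_gt0 ?h0 //.
by rewrite eqn_add2l => /eqP <-.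
Qed.

(** The first coordinate of each zero is a function of the second, so distinct zeros give distinct
    roots of the resultant of the cofactors. The resultant eliminates the outer variable only if
    both cofactors involve it; the other cases are counted directly. *)
Lemma common_zeros_leq a b c d u v (f : F -> F) (ys : seq F) :
  bideg_le a b u -> bideg_le c d v -> u != 0 -> v != 0 -> uniq ys ->
  (forall y, y \in ys -> u.[f y, y] = 0 /\ v.[f y, y] = 0) ->
  (forall h u1 v1 y, u = h * u1 -> v = h * v1 -> y \in ys -> h.[f y, y] != 0) ->
  (size ys <= a * d + b * c)%N.
Proof.
move=> bu bv u0 v0 uys uv0 sep.
have [h [u1 [v1 [eu ev r0]]]] := cofactors_of_gcd u0 v0.
have h0 : h != 0 by apply: contraNneq u0 => e; rewrite eu e mul0r.
have u10 : u1 != 0 by apply: contraNneq u0 => e; rewrite eu e mulr0.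
have v10 : v1 != 0 by apply: contraNneq v0 => e; rewrite ev e mulr0.
have z y : y \in ys -> u1.[f y, y] = 0 /\ v1.[f y, y] = 0.
  move=> yys; have [] := uv0 _ yys; have := sep _ _ _ _ eu ev yys.
  rewrite eu ev !hornerM => hn /eqP + /eqP; rewrite !mulf_eq0 (negPf hn).
  by move=> /eqP -> /eqP ->.
move: bu bv; rewrite eu ev => /(bideg_le_mulr u10 h0)/andP[ua ub] /(bideg_le_mulr v10 h0)/andP[vc vd].
have const (w : {poly {poly F}}) (m : nat) : w != 0 -> (sizeY w <= m.+1)%N -> (size w <= 1)%N ->
    (forall y, y \in ys -> w.[f y, y] = 0) -> (size ys <= m)%N.
  move=> w0 wm /size1_polyC ew wz; rewrite -ltnS; apply: leq_trans wm.
  apply: leq_trans (max_size_coefXY w 0); apply: max_poly_roots => //.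
    by apply: contraNneq w0 => e; rewrite ew e.
  by apply/allP => y /wz; rewrite {1}ew hornerC => /eqP.
have [su|su] := leqP (size u1) 1; have [sv|sv] := leqP (size v1) 1.
(* Both cofactors depend on [y] only, so [h * ('X - y0)] is a common factor vanishing at [y0]. *)
- case: ys sep z {uv0 uys const} => [//|y0 ys] sep z; exfalso.
  have y0ys : y0 \in y0 :: ys by rewrite mem_head.
  have [] := z _ y0ys; rewrite [u1]size1_polyC // [v1]size1_polyC // !hornerC.
  move=> /eqP; rewrite -/(root _ _) -dvdp_XsubCl => /dvdpP[p ep].
  move=> /eqP; rewrite -/(root _ _) -dvdp_XsubCl => /dvdpP[q eq].
  have := sep (h * ('X - y0%:P)%:P) p%:P q%:P y0; rewrite -!mulrA -!polyCM.
  rewrite (mulrC _ p) (mulrC _ q) -ep -eq -!size1_polyC // => /(_ eu ev y0ys).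
  by rewrite hornerM hornerC hornerM hornerXsubC subrr mulr0 eqxx.
(* Here [u1] depends on the inner variable only and has at most [a] roots, while [v1] involves the
   outer one, so [d] is positive and [a <= a * d]. The next case is symmetric. *)
- apply: leq_trans (leq_addr _ _); case: d vd => [|d] vd; first by case: ltngtP sv vd.
  apply: leq_trans (leq_pmulr _ _) => //.
  by apply: (const u1) => // y /z[].
- apply: leq_trans (leq_addl _ _); case: b ub => [|b] ub; first by case: ltngtP su ub.
  apply: leq_trans (leq_pmull _ _) => //.
  by apply: (const v1) => // y /z[].
have : (size ys < size (resultant u1 v1))%N.
  apply: max_poly_roots => //; apply/allP => y /z[zu zv]; exact: root_resultant zu zv.
move/leq_trans/(_ (size_resultant_leq _ _)); rewrite ltnS => /leq_trans; apply.
by rewrite mulnC leq_add ?leq_mul -?subn1 ?leq_subLR ?add1n.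
Qed.

End Gauss.

(** * Arithmetic of bidegree bounds *)

Section Bidegree.
Variable F : idomainType.
Implicit Types u v : {poly {poly F}}.

Lemma bideg_leW a b a' b' u : bideg_le a b u -> (a <= a')%N -> (b <= b')%N -> bideg_le a' b' u.
Proof.
by move=> /andP[ha hb] aa bb; apply/andP; split;
  [apply: leq_trans ha _ | apply: leq_trans hb _]; rewrite ltnS.
Qed.

Lemma bideg_leD a b u v : bideg_le a b u -> bideg_le a b v -> bideg_le a b (u + v).
Proof.
move=> /andP[ua ub] /andP[va vb]; move: ua va; rewrite /bideg_le !sizeYE rmorphD /= => ua va.
by apply/andP; split; apply: leq_trans (size_polyD _ _) _; rewrite geq_max ?ua ?ub.
Qed.

Lemma bideg_leN a b u : bideg_le a b u -> bideg_le a b (- u).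
Proof. by rewrite /bideg_le !sizeYE rmorphN /= !size_polyN. Qed.

Lemma bideg_leM a b c d u v :
  bideg_le a b u -> bideg_le c d v -> bideg_le (a + c) (b + d) (u * v).
Proof.
move=> /andP[ua ub] /andP[va vb]; move: ua va; rewrite /bideg_le !sizeYE rmorphM /= => ua va.
apply/andP; split; apply: leq_trans (size_polyMleq _ _) _;
  rewrite -subn1 leq_subLR add1n -addnS -addSn; exact: leq_add.
Qed.

Lemma bideg_leC (c : F) : bideg_le 0 0 c%:P%:P.
Proof.
by rewrite /bideg_le sizeYE swapXY_polyC map_polyC /= !size_polyC; case: eqP => //; case: eqP.
Qed.

Lemma bideg_le0 a b : bideg_le a b (0 : {poly {poly F}}).
Proof. by rewrite /bideg_le sizeYE rmorph0 !size_poly0. Qed.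

Lemma bideg_le1 a b : bideg_le a b (1 : {poly {poly F}}).
Proof. by rewrite /bideg_le sizeYE rmorph1 !size_poly1. Qed.

Lemma bideg_leCM (c : F) a b u : bideg_le a b u -> bideg_le a b (c%:P%:P * u).
Proof. exact: bideg_leM (bideg_leC c). Qed.

Lemma bideg_le_Y : bideg_le 1 0 ('X%:P : {poly {poly F}}).
Proof. by rewrite /bideg_le sizeYE swapXY_Y size_polyX size_polyC; case: eqP. Qed.

End Bidegree.

(** * Lensing polynomials *)

(* Keeping the field abstract prevents its concrete ring structures from being
   unfolded during unification. *)
Record complex_model := ComplexModel {
  CC : closedFieldType;
  phi : C -> CC;
  psi : CC -> C;
  cj : {rmorphism CC -> CC};
  phiK : cancel phi psi;
  psiK : cancel psi phi;
  phi0 : phi (RtoC 0) = 0;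
  phiD : {morph phi : z t / Cplus z t >-> z + t};
  phiB : {morph phi : z t / Cminus z t >-> z - t};
  phiM : {morph phi : z t / Cmult z t >-> z * t};
  phi_div : {morph phi : z t / Cdiv z t >-> z / t};
  phi_conj : forall z, phi (Cconj z) = cj (phi z)
}.

(** The two inverses also agree at zero, so [phi_div] holds without a side condition. *)
Lemma phi_inv_complex (z : C) :
  Complex (fst (Cinv z)) (snd (Cinv z)) = (Complex (fst z) (snd z))^-1 :> complex R.
Proof.
case: z => a b.
have -> : (Complex a b)^-1 = Complex (a / (a ^+ 2 + b ^+ 2)) (- (b / (a ^+ 2 + b ^+ 2))) by [].
by rewrite /= !Rmult_1_r !RdivE !RplusE !RmultE RoppE mulNr !expr2.
Qed.

Definition complex_model_R : complex_model.
Proof.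
refine (@ComplexModel (complex R)
  (fun z => Complex (fst z) (snd z)) (fun x => let: Complex a b := x in (a, b)) (@conjc R)
  _ _ _ _ _ _ _ _); try by [].
- by case.
- by case.
- by move=> z t; rewrite /Cdiv -phi_inv_complex.
Defined.

Section Evaluation.
Variable M : complex_model.
Local Notation CC := (CC M).
Local Notation phi := (@phi M).
Local Notation cj := (@cj M).
Implicit Types u v : {poly {poly CC}}.

Lemma phi_inj : injective phi. Proof. exact: can_inj (@phiK M). Qed.

Lemma cjK : involutive cj.
Proof. by move=> x; rewrite -(psiK x) -!phi_conj Cconj_conj. Qed.

Lemma cj_eq0 x : (cj x == 0) = (x == 0).
Proof. by rewrite fmorph_eq0. Qed.

(* The first variable stands for the conjugate of the second. *)
Definition ev u (z : C) : CC := u.[cj (phi z), phi z].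

Lemma ev0 z : ev 0 z = 0.
Proof. by rewrite /ev !horner0. Qed.
Lemma ev1 z : ev 1 z = 1.
Proof. by rewrite /ev !hornerC. Qed.
Lemma evD u v z : ev (u + v) z = ev u z + ev v z.
Proof. by rewrite /ev !hornerD. Qed.
Lemma evN u z : ev (- u) z = - ev u z.
Proof. by rewrite /ev !hornerN. Qed.
Lemma evM u v z : ev (u * v) z = ev u z * ev v z.
Proof. by rewrite /ev !hornerM. Qed.
Lemma evC c z : ev c%:P%:P z = c.
Proof. by rewrite /ev !hornerC. Qed.
Lemma evX z : ev 'X z = cj (phi z).
Proof. by rewrite /ev hornerX hornerC. Qed.
Lemma evY z : ev 'X%:P z = phi z.
Proof. by rewrite /ev hornerC hornerX. Qed.

(** Conjugating a value at [(conj z, z)] exchanges the two variables and conjugates the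
    coefficients. *)
Definition star u : {poly {poly CC}} := map_poly (map_poly cj) (swapXY u).

Lemma ev_star u z : ev (star u) z = cj (ev u z).
Proof.
rewrite /ev /star -{2}(cjK (phi z)) -(horner2_swapXY u).
by rewrite -horner_map /= -horner_map /= map_polyC.
Qed.

Lemma size_map_cj u : size (map_poly (map_poly cj) u) = size u.
Proof.
apply: size_map_inj_poly; last exact: rmorph0.
by apply: map_inj_poly; [exact: fmorph_inj | exact: rmorph0].
Qed.

Lemma bideg_le_star a b u : bideg_le a b u -> bideg_le b a (star u).
Proof. by rewrite /bideg_le /star !sizeYE swapXY_map !size_map_cj swapXYK andbC. Qed.

Lemma star_eq0 u : (star u == 0) = (u == 0).
Proof. by rewrite -size_poly_eq0 size_map_cj size_poly_eq0 swapXY_eq0. Qed.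

End Evaluation.

(** * Clearing denominators plane by plane *)

Section Planes.
Variable M : complex_model.
Local Notation CC := (CC M).
Local Notation phi := (@phi M).
Local Notation cj := (@cj M).

(** Here [conj t = u / v], so the denominator of the [l]-th term is [f / v] with
    [f = u - conj (s l) v]. [A] is the product of the [f], and [B] comes from adding fractions:
    [m v / f + B / A = (m v A + f B) / (f A)]. *)
Lemma deflection_fraction (p q : nat) (u v : {poly {poly CC}}) (ls : list nat)
    (m : nat -> R) (s : nat -> C) :
  bideg_le p q u -> bideg_le p q v ->
  exists A B, [/\ bideg_le (length ls * p) (length ls * q) A,
    bideg_le (length ls * p) (length ls * q) B &
    forall z t, ev v z != 0 -> cj (phi t) * ev v z = ev u z ->
      (ev A z != 0 <-> (forall l, In l ls -> t <> s l)) /\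
      (ev A z != 0 ->
       phi (Csum (List.map (fun l => Cdiv (RtoC (m l)) (Cminus (Cconj t) (Cconj (s l)))) ls))
         * ev A z = ev B z)].
Proof.
move=> bu bv; elim: ls => [|l ls [A [B [bA bB AB]]]].
  exists 1, 0; split; rewrite ?mul0n.
  - exact: bideg_le1.
  - exact: bideg_le0.
  move=> z t _ _.
  rewrite ev1 ev0 oner_neq0; split; first by split=> // _ ? [].
  by rewrite /= phi0 mulr1.
pose f := u - (cj (phi (s l)))%:P%:P * v.
have bf : bideg_le p q f by apply: bideg_leD => //; apply: bideg_leN; apply: bideg_leCM.
exists (f * A), ((phi (RtoC (m l)))%:P%:P * v * A + f * B); split.
- by rewrite /= !mulSn; apply: bideg_leM.
- rewrite /= !mulSn; apply: bideg_leD; last exact: bideg_leM.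
  by apply: bideg_leM => //; apply: bideg_leCM.
move=> z t v0 e; have [A0 Asum] := AB z t v0 e.
have fE : ev f z = cj (phi t - phi (s l)) * ev v z.
  by rewrite evD evN evM evC -e rmorphB /= mulrBl.
clearbody f.
split.
  rewrite evM mulf_eq0 negb_or fE mulf_eq0 negb_or v0 andbT cj_eq0 subr_eq0.
  split.
    by move=> /andP[/eqP tl /A0 h] l' [<- e'|/h//]; apply: tl; rewrite e'.
  move=> h; apply/andP; split; last by apply/A0 => l' ll'; apply: h; right.
  by apply/eqP => /phi_inj; apply: h; left.
rewrite !evM !evD !evM evC mulf_eq0 negb_or => /andP[f0 a0].
rewrite [Csum _]/= phiD phi_div phiB !phi_conj -rmorphB /= mulrDl; congr (_ + _); last first.
  by rewrite mulrCA Asum.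
rewrite fE mulrA [_ * (_ * ev v z)]mulrA divfK //.
by apply: contraNneq f0 => e0; rewrite fE e0 mul0r.
Qed.

Variables (g : nat -> nat) (y : nat -> nat -> C) (m : nat -> nat -> R) (beta : nat -> nat -> R).

Local Notation X := (xpos g y m beta).

Lemma length_xs_list n z : length (xs_list g y m beta n z) = n.
Proof. by elim: n => //= n IH; rewrite length_app IH /= plusE addn1. Qed.

Lemma xpos_stable n i z : (0 < i <= n)%N -> X n i z = X i i z.
Proof.
move=> /andP[i0]; elim: n => [|n IH]; first by rewrite leqNgt i0.
rewrite leq_eqVlt => /predU1P[->//|/ltnSE le_in]; rewrite -IH //.
rewrite /xpos /= app_nth1 // length_xs_list minusE; apply/ltP.
by apply: leq_trans le_in; rewrite subn1 prednK.
Qed.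

Lemma xposS n z : X n.+1 n.+1 z = Cminus z (Csum (List.map
  (fun j => Cmult (RtoC (beta j n.+1)) (alpha g y m j (X j j z))) (List.seq 1 n))).
Proof.
rewrite {1}/xpos minusE subn1 /= app_nth2 length_xs_list ?minusE ?subnn //=.
congr (Cminus _ (Csum _)); apply: map_ext_in => j /in_seq[/leP j1 /leP jn].
rewrite -(xpos_stable z (n := n)) //; rewrite /= in jn; exact/andP.
Qed.

(* [(E_n, O_n)], by splitting the recursion [F_(n+1) = F_n (1 + g_(n+1) Z)] into parities. *)
Fixpoint even_odd (n : nat) : nat * nat :=
  if n is k.+1 then
    ((even_odd k).1 + g n * (even_odd k).2, (even_odd k).2 + g n * (even_odd k).1)%N
  else (1, 0)%N.

Local Notation ee n := (even_odd n).1.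
Local Notation oo n := (even_odd n).2.

Lemma even_gt0 n : (0 < ee n)%N.
Proof. by elim: n => //= n IH; rewrite addn_gt0 IH. Qed.

(** The invariant of the induction on planes. The predecessor on [ee n] leaves room for the factor
    [z] that appears when [z] itself is put over [D]. *)
Definition denominator n (D : {poly {poly CC}}) :=
  [/\ bideg_le (ee n).-1 (oo n) D,
      forall z, ev D z != 0 <-> in_domain g y m beta n z &
      forall j, (0 < j <= n)%N -> exists2 T, bideg_le (ee n).-1 (oo n) T &
        forall z, ev D z != 0 -> phi (alpha g y m j (X j j z)) * ev D z = ev T z].

(** The coefficients [c] are left free to cover both uses: [beta] gives the next position [x_(n+1)],
    and the constant 1 gives [eta]. *)
Lemma numerator n D (c : nat -> R) : denominator n D ->
  exists2 N, bideg_le (ee n) (oo n) N & forall z, ev D z != 0 ->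
    phi (Cminus z (Csum (List.map (fun j => Cmult (RtoC (c j)) (alpha g y m j (X j j z)))
       (List.seq 1 n)))) * ev D z = ev N z.
Proof.
move=> [bD _ hM].
have [S bS hS] : exists2 S, bideg_le (ee n).-1 (oo n) S & forall z, ev D z != 0 ->
    phi (Csum (List.map (fun j => Cmult (RtoC (c j)) (alpha g y m j (X j j z)))
       (List.seq 1 n))) * ev D z = ev S z.
  have: forall j, In j (List.seq 1 n) -> (0 < j <= n)%N.
    by move=> j /in_seq[/leP j1 /leP jn]; apply/andP.
  elim: (List.seq 1 n) => [|j ls IH] jls.
    exists 0 => [|z _]; first exact: bideg_le0.
    by rewrite ev0 /= phi0 mul0r.
  have [S bS hS] := IH (fun i h => jls i (or_intror h)).
  have [T bT hMj] := hM j (jls j (or_introl erefl)).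
  exists ((phi (RtoC (c j)))%:P%:P * T + S).
    by apply: bideg_leD => //; apply: bideg_leCM.
  move=> z D0; rewrite evD evM evC -(hMj z) // -(hS z) //.
  by rewrite [Csum _]/= phiD phiM mulrDl mulrA.
exists ('X%:P * D - S) => [|z D0].
  apply: bideg_leD.
    by have := bideg_leM (bideg_le_Y _) bD; rewrite add0n add1n prednK ?even_gt0.
  by apply: bideg_leN; apply: bideg_leW bS (leq_pred _) (leqnn _).
by rewrite evD evN evM evY -(hS z) // phiB mulrBl.
Qed.

(** Since [x_(n+1) = N / D] has bidegree [(E_n, O_n)], its conjugate has bidegree [(O_n, E_n)], and
    plane [n+1] contributes a denominator [A] of bidegree [g_(n+1)] times that. Then [D * A] has
    bidegree [(E_n - 1 + g_(n+1) O_n, O_n + g_(n+1) E_n)], as the recursion requires. *)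
Lemma denominator_exists n : exists D, denominator n D.
Proof.
elim: n => [|n [D dD]].
  exists 1; split; first exact: bideg_le1.
  - move=> z; rewrite ev1 oner_eq0; split=> // _ i l [/leP i1 /leP i0].
    by have := leq_trans i1 i0.
  - by case.
have [N bN hN] := numerator (fun j => beta j n.+1) dD.
have [bD Ddom hM] := dD.
have bD' : bideg_le (ee n) (oo n) D by apply: bideg_leW bD (leq_pred _) (leqnn _).
have [A [B [bA bB hAB]]] := deflection_fraction (List.seq 1 (g n.+1)) (m n.+1) (y n.+1)
  (bideg_le_star bN) (bideg_le_star bD').
rewrite length_seq in bA bB.
have hX z : ev D z != 0 -> cj (phi (X n.+1 n.+1 z)) * ev (star D) z = ev (star N) z.
  by move=> D0; rewrite !ev_star -rmorphM xposS hN.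
have sD z : ev D z != 0 -> ev (star D) z != 0 by rewrite ev_star cj_eq0.
have bDM u v : bideg_le (ee n).-1 (oo n) u ->
    bideg_le (g n.+1 * oo n) (g n.+1 * ee n) v ->
    bideg_le (ee n.+1).-1 (oo n.+1) (u * v).
  move=> bu bv; have := bideg_leM bu bv; congr bideg_le => /=.
  by rewrite -[in RHS](prednK (even_gt0 n)).
exists (D * A); split; first exact: bDM.
- move=> z; rewrite evM mulf_eq0 negb_or; split.
    move=> /andP[D0 A0] i l [/leP i1 /leP]; rewrite leq_eqVlt => /predU1P[->|/ltnSE le_in] hl.
      have [/(_ A0) + _] := (hAB _ _ (sD _ D0) (hX _ D0)).1; apply.
      by apply/in_seq; split; [case: hl|case: hl => _ /leP hl; apply/leP].
    rewrite xpos_stable ?i1 ?(leqW le_in) // -(xpos_stable z (n := n)) ?i1 //.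
    by apply: (Ddom z).1 => //; split; apply/leP.
  move=> hdom; have D0 : ev D z != 0.
    apply/Ddom => i l [/leP i1 /leP le_in] hl.
    rewrite xpos_stable ?i1 // -(xpos_stable z (n := n.+1)) ?i1 ?leqW //.
    by apply: hdom => //; split; apply/leP => //; apply: leqW.
  rewrite D0; apply/(hAB _ _ (sD _ D0) (hX _ D0)).1 => l /in_seq[l1 /leP lg].
  by apply: hdom; split => //; apply/leP.
move=> j /andP[j1]; rewrite leq_eqVlt => /predU1P[->|/ltnSE le_jn].
  exists (D * B) => [|z]; first exact: bDM.
  rewrite !evM mulf_eq0 negb_or => /andP[D0 A0].
  have [_ /(_ A0) <-] := hAB _ _ (sD _ D0) (hX _ D0).
  by rewrite mulrCA.
have [|T bT hMj] := hM j; first by rewrite j1.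
exists (T * A) => [|z]; first exact: bDM.
by rewrite !evM mulf_eq0 negb_or => /andP[D0 A0]; rewrite mulrA hMj.
Qed.

End Planes.

(** * The Jacobian at a zero of a common factor *)

Section Jacobian.
Variable M : complex_model.
Local Notation CC := (CC M).
Local Notation phi := (@phi M).
Local Notation psi := (@psi M).
Local Notation cj := (@cj M).
Implicit Types u v h : {poly {poly CC}}.

Lemma psiD x y : psi (x + y) = Cplus (psi x) (psi y).
Proof. by apply: (@phi_inj M); rewrite phiD !psiK. Qed.
Lemma psiM x y : psi (x * y) = Cmult (psi x) (psi y).
Proof. by apply: (@phi_inj M); rewrite phiM !psiK. Qed.

Lemma Ccont_ev u (p : R -> C) t : Ccont p t -> Ccont (fun s => psi (ev u (p s))) t.
Proof.
move=> cp.
have cz (c : {poly CC}) : Ccont (fun s => psi (ev c%:P (p s))) t.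
  elim/poly_ind: c => [|c x IH].
    rewrite polyC0; apply: (@Ccont_ext (fun _ => psi 0)) (Ccont_const _ _) => s.
    by rewrite ev0.
  apply: (@Ccont_ext (fun s => Cplus (Cmult (psi (ev c%:P (p s))) (p s)) (psi x))).
    by move=> s; rewrite polyCD polyCM evD evM evY evC psiD psiM phiK.
  by apply: Ccont_plus (Ccont_const _ _); apply: Ccont_mult.
elim/poly_ind: u => [|u c IH]; first by rewrite -polyC0; apply: cz.
apply: (@Ccont_ext (fun s => Cplus (Cmult (psi (ev u (p s))) (Cconj (p s))) (psi (ev c%:P (p s))))).
  by move=> s; rewrite evD evM evX psiD psiM -phi_conj phiK.
by apply: Ccont_plus (cz _); apply: Ccont_mult => //; apply: Ccont_conj.
Qed.

(** Dividing by [conj z - a] leaves the remainder [h.[a%:P]], a polynomial in [z] alone that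
    vanishes at [b] and is therefore divisible by [z - b]. *)
Lemma first_order h z0 : ev h z0 = 0 -> exists r s, forall z,
  ev h z = cj (phi z - phi z0) * ev r z + (phi z - phi z0) * ev s z.
Proof.
set a := cj (phi z0); set b := phi z0 => h0.
have : root (h.[a%:P]) b by rewrite /root -/(ev h z0) h0.
rewrite -dvdp_XsubCl => /dvdpP[s es].
have : root (h - h.[a%:P]%:P) a%:P by rewrite /root hornerD hornerN hornerC subrr.
case/factor_theorem => r er.
exists r, s%:P => z.
rewrite -[h](subrK h.[a%:P]%:P) er es evD !evM polyCM evM.
have evXa : ev ('X - a%:P%:P) z = cj (phi z - b) by rewrite evD evN evX evC rmorphB.
have evYb : ev ('X - b%:P)%:P z = phi z - b by rewrite polyCB evD evN evY evC.
by rewrite evXa evYb mulrC [ev s%:P z * _]mulrC.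
Qed.

(** On a line through [z0], [h] is the real parameter times a continuous [k], so [f - w] and its
    conjugate factor through [k] times [u / D] and [k] times [v / star D]. At [z0] only [k] depends
    on the direction, so the two partial derivatives are parallel. *)
Lemma jacobian_eq0 (f : C -> C) (w z0 : C) D N h u v :
  (forall z, ev D z != 0 -> phi (Cminus (f z) w) * ev D z = ev N z) ->
  ev D z0 != 0 -> N = h * u -> star N = h * v -> ev h z0 = 0 ->
  (Derive (fun a => fst (f (a, snd z0))) (fst z0) * Derive (fun b => snd (f (fst z0, b))) (snd z0)
  - Derive (fun b => fst (f (fst z0, b))) (snd z0) * Derive (fun a => snd (f (a, snd z0))) (fst z0))%R
   = 0%R.
Proof.
move=> hN D0 eu ev' h0; have [r [s hrs]] := first_order h0.
(* [p] parametrizes the line through [z0] with direction [d], reaching [z0] at parameter [t]; it is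
   used below with [d = 1] and [d = Ci]. *)
have key (p : R -> C) t (d : C) : Ccont p t -> p t = z0 ->
    (forall x, Cminus (p x) z0 = Cmult (RtoC (Rminus x t)) d) ->
    let k x := psi (ev r (p x) * cj (phi d) + ev s (p x) * phi d) in
    let h1 x := Cdiv (psi (ev u (p x))) (psi (ev D (p x))) in
    let h2 x := Cdiv (psi (ev v (p x))) (psi (ev (star D) (p x))) in
    Derive (fun x => fst (f (p x))) t = fst (Cmult (k t) (h1 t)) /\
    Derive (fun x => snd (f (p x))) t = snd (Cmult (k t) (h1 t)) /\
    Cconj (Cmult (k t) (h1 t)) = Cmult (k t) (h2 t).
  move=> cp pt hp k h1 h2.
  have psi0 x : x != 0 -> psi x <> RtoC 0.
    by move=> x0 e; case/eqP: x0; rewrite -(psiK x) e phi0.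
  have cjR (x : R) : cj (phi (RtoC x)) = phi (RtoC x).
    by rewrite -phi_conj; congr phi; rewrite /Cconj /= Ropp_0.
  have nearD : locally t (fun x => psi (ev D (p x)) <> RtoC 0).
    by apply: Ccont_neq0 (Ccont_ev D cp) _; rewrite pt; apply: psi0.
  have hk x : ev h (p x) = phi (RtoC (Rminus x t)) * phi (k x).
    by rewrite hrs -phiB hp phiM rmorphM cjR psiK mulrDr !mulrA -!(mulrAC _ _ (ev _ _)).
  apply: Cderive_line.
  - move: nearD; apply: filter_imp => x nx; apply: (@phi_inj M).
    have Dx : ev D (p x) != 0 by apply: contra_not_neq nx => ->; apply: (@phi_inj M); rewrite psiK phi0.
    by rewrite /h1 phiM phi_div phiM -hk !psiK mulrA -evM -eu -hN // mulfK.
  - move: nearD; apply: filter_imp => x nx; apply: (@phi_inj M).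
    have Dx : ev D (p x) != 0 by apply: contra_not_neq nx => ->; apply: (@phi_inj M); rewrite psiK phi0.
    rewrite /h2 phiM phi_div phiM -hk !psiK mulrA -evM -ev' !ev_star -hN // rmorphM mulfK ?phi_conj //.
    by rewrite cj_eq0.
  - apply: (@Ccont_ext (fun x => Cplus (Cmult (psi (ev r (p x))) (Cconj d)) (Cmult (psi (ev s (p x))) d))).
      by move=> x; rewrite /k psiD !psiM -phi_conj !phiK.
    by apply: Ccont_plus; apply: Ccont_mult (Ccont_const _ _); apply: Ccont_ev.
  - by apply: Ccont_div; rewrite ?pt; try exact: Ccont_ev; apply: psi0.
  - by apply: Ccont_div; rewrite ?pt; try exact: Ccont_ev; apply: psi0; rewrite ev_star cj_eq0.
case: z0 h0 D0 hrs key => a b h0 D0 hrs key /=.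
have cid t : continuity_pt (fun x : R => x) t by apply: derivable_continuous_pt; apply: derivable_pt_id.
have [] := key (fun x => (x, b)) a (RtoC 1).
- by split=> //=; apply: continuity_pt_const.
- by [].
- by move=> x; apply: injective_projections; rewrite /=; ring.
move=> -> [-> e1].
have [] := key (fun x => (a, x)) b Ci.
- by split=> //=; apply: continuity_pt_const.
- by [].
- by move=> x; apply: injective_projections; rewrite /=; ring.
move=> -> [-> e2]; exact: jacobian_of_common_factor e1 e2.
Qed.

End Jacobian.

(** * Counting the images *)

Section Images.
Variable M : complex_model.
Local Notation phi := (@phi M).
Local Notation cj := (@cj M).

Lemma in_phi (s : list C) y : y \in List.map phi s -> exists2 x, In x s & y = phi x.
Proof.
elim: s => //= x s IH; rewrite inE => /predU1P[->|/IH[t ts ->]]; first by exists x; [left|].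
by exists t => //; right.
Qed.

Lemma uniq_phi (s : list C) : NoDup s -> uniq (List.map phi s).
Proof.
elim=> //= x s' xs' _ ->; rewrite andbT; apply/negP => /in_phi[t ts' /phi_inj e].
by apply: xs'; rewrite e.
Qed.

Lemma images_leq K g y m beta w (imgs : list C) :
  ~ caustic_point g y m beta K w -> NoDup imgs ->
  (forall x, In x imgs -> is_image g y m beta K w x) ->
  (length imgs <= (even_odd g K).1 * (even_odd g K).1 + (even_odd g K).2 * (even_odd g K).2)%N.
Proof.
move=> nc nd him; have [D dD] := @denominator_exists M g y m beta K.
have [N bN hN] := numerator (fun _ => R1) dD.
have [bD Ddom _] := dD.
pose u := N - (phi w)%:P%:P * D.
have bu : bideg_le (even_odd g K).1 (even_odd g K).2 u.
  apply: bideg_leD => //; apply: bideg_leN; apply: bideg_leCM.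
  by apply: bideg_leW bD (leq_pred _) (leqnn _).
have hu z : ev D z != 0 -> phi (Cminus (eta g y m beta K z) w) * ev D z = ev u z.
  move=> D0; rewrite phiB mulrBl evD evN evM evC -(hN z) //; congr (phi (Cminus _ (Csum _)) * _ - _).
  apply: map_ext_in => j /in_seq[/leP j1 /leP jn]; rewrite Cmult_1_l xpos_stable //.
  by apply/andP.
(* A common factor vanishing at an image would make that image a critical point, and [w] a caustic
   point. *)
have sep h u1 v1 x : u = h * u1 -> star u = h * v1 -> In x imgs -> ev h x != 0.
  move=> eu ev' /him[xdom ex]; apply/eqP => h0; apply: nc; exists x; split=> //; split=> //.
  apply: (jacobian_eq0 hu _ eu ev' h0); exact/Ddom.
case: imgs => [//|x0 imgs] in nd him sep *.
have x0i : In x0 (x0 :: imgs) by left.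
(* If [u] were zero, then 0 would be a common factor of [u] and [star u] vanishing at the image
   [x0], against [sep]. *)
have u0 : u != 0.
  apply/eqP => u0; have := @sep 0 0 0 x0; rewrite !mul0r ev0 eqxx => /(_ u0) h.
  by have := h (eqP (etrans (star_eq0 u) (introT eqP u0))) x0i.
have -> : length (x0 :: imgs) = size (List.map phi (x0 :: imgs)) by rewrite -(length_map phi).
(* The bidegrees are [(E, O)] for [u] and [(O, E)] for [star u], so [a * d + b * c] becomes
   [E * E + O * O]. *)
apply: (common_zeros_leq (f := cj) bu (bideg_le_star bu) u0); rewrite ?star_eq0 //.
- exact: uniq_phi.
- move=> _ /in_phi[x xi ->]; have [/Ddom xD ex] := him x xi.
  have e : ev u x = 0 by rewrite -hu // ex phiB subrr mul0r.
  by split; [exact: e | rewrite -/(ev (star u) x) ev_star e rmorph0].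
- by move=> h u1 v1 _ eu ev' /in_phi[x xi ->]; apply: sep eu ev' xi.
Qed.

End Images.

End Lensing.

(** * The parity recursion and the values of F at 1 and -1 *)

Lemma Fpoly_even_odd g n :
  Fpoly g n 1 = INR (fst (Lensing.even_odd g n)) + INR (snd (Lensing.even_odd g n)) /\
  Fpoly g n (-1) = INR (fst (Lensing.even_odd g n)) - INR (snd (Lensing.even_odd g n)).
Proof.
assert (FS : forall n x, Fpoly g (S n) x = Fpoly g n x * (1 + INR (g (S n)) * x)).
{ intros k x; unfold Fpoly; rewrite seq_S, map_app, fold_right_app; simpl.
  (* The factor of the last plane has become the initial value of the fold; it is generalized so
     that induction can pull it out. *)
  rewrite Rmult_1_r; generalize (1 + INR (g (S k)) * x).
  induction (map (fun i => 1 + INR (g i) * x) (seq 1 k)) as [|c l IH]; intros d; simpl; [ring|].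
  rewrite IH; ring. }
induction n as [|n [IH1 IH2]]; [split; unfold Fpoly; simpl; ring|].
rewrite !FS, IH1, IH2; simpl.
set (e := fst (Lensing.even_odd g n)); set (o := snd (Lensing.even_odd g n)).
change (ssrnat.addn e (ssrnat.muln (g (S n)) o)) with (e + g (S n) * o)%nat.
change (ssrnat.addn o (ssrnat.muln (g (S n)) e)) with (o + g (S n) * e)%nat.
rewrite !plus_INR, !mult_INR; split; ring.
Qed.

Theorem theorem1 (K : nat) (g : nat -> nat) (y : nat -> nat -> C)
  (m : nat -> nat -> R) (beta : nat -> nat -> R) (w : C) :
  (1 <= K)%nat ->
  (forall i, (1 <= i <= K)%nat -> (1 <= g i)%nat) ->
  (forall i l, (1 <= i <= K)%nat -> (1 <= l <= g i)%nat -> 0 < m i l) ->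
  (forall j i, (1 <= j)%nat -> (j < i)%nat -> (i <= K)%nat -> beta j i <> 0) ->
  (* genericity: finitely many images, and w is not a caustic point *)
  (exists L : list C, forall x, is_image g y m beta K w x -> In x L) ->
  ~ caustic_point g y m beta K w ->
  forall imgs : list C, NoDup imgs ->
    (forall x, In x imgs -> is_image g y m beta K w x) ->
    INR (length imgs) <= E_K g K ^ 2 + O_K g K ^ 2.
Proof.
intros _ _ _ _ _ nc imgs nd him.
pose proof (Lensing.images_leq Lensing.complex_model_R nc nd him) as h.
apply (ssrbool.elimT ssrnat.leP) in h; apply le_INR in h.
apply (Rle_trans _ _ _ h); right.
unfold E_K, O_K; destruct (Fpoly_even_odd g K) as [-> ->].
set (e := fst _); set (o := snd _).
change (ssrnat.addn (ssrnat.muln e e) (ssrnat.muln o o)) with (e * e + o * o)%nat.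
rewrite plus_INR, !mult_INR; field.
Qed.
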